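(* Let $n\in\mathbb{N}$ and let $C,\widehat{C}\in\mathbb{R}^{n\times n}$ be symmetric positive semidefinite matrices such that $C-\widehat{C}$ is symmetric positive semidefinite. Let $\kappa:=\mathrm{N}(0,C)$ and $\widehat{\kappa}:=\mathrm{N}(0,\widehat{C})$ be the Gaussian measures on $\mathbb{R}^n$ with mean zero and covariance matrices $C$ and $\widehat{C}$, respectively. Then $$\mathrm{W}_2(\kappa,\widehat{\kappa})\le \operatorname{trace}(C-\widehat{C})^{1/2}.$$
   Context: $\mathrm{N}(0,C)$ denotes the (possibly degenerate) Gaussian probability measure on $\mathbb{R}^n$ with its Borel $\sigma$-algebra $\mathcal{B}\mathbb{R}^n$, with mean $0$ and covariance matrix $C$ (symmetric positive semidefinite, possibly singular). For probability measures $\nu,\widehat{\nu}$ on $(\mathbb{R}^n,\mathcal{B}\mathbb{R}^n)$, let $\mathrm{Coup}(\nu,\widehat{\nu})$ be the set of probability measures $H$ on $(\mathbb{R}^{2n},\mathcal{B}\mathbb{R}^{2n})$ with $H(B\times\mathbb{R}^n)=\nu(B)$ and $H(\mathbb{R}^n\times B)=\widehat{\nu}(B)$ for all $B\in\mathcal{B}\mathbb{R}^n$. The Wasserstein-2 distance is $$\mathrm{W}_2(\nu,\widehat{\nu}):=\left(\inf_{H\in\mathrm{Coup}(\nu,\widehat{\nu})}\int_{\mathbb{R}^{2n}}\|X_1-X_2\|_2^2\,H(\mathrm{d}X_1,\mathrm{d}X_2)\right)^{1/2},$$ where $\|\cdot\|_2$ is the Euclidean norm. *)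

(* Defs.v *)
From HB Require Import structures.
From mathcomp Require Import all_boot all_order all_algebra.
From mathcomp Require Import all_classical all_reals all_analysis.

Set Implicit Arguments.
Unset Strict Implicit.
Unset Printing Implicit Defensive.

Import Order.TTheory GRing.Theory Num.Theory.
Import numFieldNormedType.Exports.

Local Open Scope classical_set_scope.
Local Open Scope ring_scope.

(* R^n is [n.-tuple R]; the library equips it with the sigma-algebra generated
   by the coordinates, which is the Borel sigma-algebra of R^n.  R^(2n) is the
   product [n.-tuple R * n.-tuple R] with the product sigma-algebra. *)

Definition psdmx (R : realType) (n : nat) (C : 'M[R]_n) : Prop :=
  C^T = C /\ forall v : 'cV[R]_n, 0 <= (v^T *m C *m v) 0 0.

Definition norm2 (R : realType) (n : nat) (x : n.-tuple R) : R :=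
  Num.sqrt (\sum_(i < n) tnth x i ^+ 2).

Definition subt (R : realType) (n : nat) (x y : n.-tuple R) : n.-tuple R :=
  [tuple tnth x i - tnth y i | i < n].

Definition affine (R : realType) (n k : nat) (A : 'M[R]_(n, k))
    (b : n.-tuple R) (z : k.-tuple R) : n.-tuple R :=
  [tuple \sum_(j < k) A i j * tnth z j + tnth b i | i < n].

(* The joint law of k independent N(0, 1) random variables; a probability is
   determined by its values on measurable boxes. *)
Definition std_gaussian (R : realType) (k : nat)
    (g : probability (k.-tuple R) R) : Prop :=
  forall B : 'I_k -> set R, (forall i, measurable (B i)) ->
    g [set z | forall i, B i (tnth z i)] =
    (\prod_(i < k) normal_prob 0 1 (B i))%E.

(* Possibly degenerate Gaussian measures: the laws of A Z + b with Z a standard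
   Gaussian vector of some dimension k.  No rank condition is put on A. *)
Definition gaussian (R : realType) (n : nat)
    (mu : probability (n.-tuple R) R) : Prop :=
  exists (k : nat) (A : 'M[R]_(n, k)) (b : n.-tuple R)
         (g : probability (k.-tuple R) R),
    std_gaussian g /\
    forall B : set (n.-tuple R), measurable B ->
      mu B = pushforward g (affine A b) B.

Definition centered_gaussian (R : realType) (n : nat) (C : 'M[R]_n)
    (mu : probability (n.-tuple R) R) : Prop :=
  [/\ gaussian mu,
      forall i : 'I_n, expectation mu (fun x => tnth x i) = 0%E &
      forall i j : 'I_n,
        covariance mu (fun x => tnth x i) (fun x => tnth x j) = (C i j)%:E].

Definition coupling (R : realType) (n : nat)
    (nu nu' : probability (n.-tuple R) R) :
    set (probability (n.-tuple R * n.-tuple R)%type R) :=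
  [set H | forall B : set (n.-tuple R), measurable B ->
     H (B `*` setT) = nu B /\ H (setT `*` B) = nu' B].

Definition W2 (R : realType) (n : nat)
    (nu nu' : probability (n.-tuple R) R) : \bar R :=
  sqrte (ereal_inf [set (\int[H]_X (norm2 (subt X.1 X.2) ^+ 2)%:E)%E
                   | H in coupling nu nu']).

(* Main.v *)
Require Import Defs.
From HB Require Import structures.
From mathcomp Require Import all_boot all_order all_algebra.
From mathcomp Require Import all_classical all_reals all_analysis.
From mathcomp Require Import measurable_realfun ring lra.

Set Implicit Arguments.
Unset Strict Implicit.
Unset Printing Implicit Defensive.

Import Order.TTheory GRing.Theory Num.Theory.
Import numFieldNormedType.Exports.

Local Open Scope classical_set_scope.
Local Open Scope ring_scope.

(** If [Y] has law [N(0, Chat)] and [W] is an independent vector of law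
    [N(0, C - Chat)], which exists because [C - Chat] is positive semidefinite,
    then [Y + W] is centered Gaussian with covariance [C], so [(Y + W, Y)] is a
    coupling of the two measures, and its cost is the trace of the covariance of
    [W].  The point that needs work is that [Y + W] has law [kappa]: a centered
    Gaussian law is determined by its covariance matrix, however it is presented
    as the image of a standard Gaussian vector.

    A centered Gaussian law is the law of [(u_1 . Z, ..., u_n . Z)] for vectors
    [u_i] with Gram matrix [C] and a standard Gaussian vector [Z]
    ([centered_gaussian_lin]).  Two families of vectors of the same space with
    the same Gram matrix are exchanged by a product of reflections, built one
    vector at a time: if the families agree on some indices and differ at [i],
    the reflection along [u_i - v_i] sends [u_i] to [v_i] and fixes the vectors on
    which they already agree, since these are orthogonal to [u_i - v_i].  Hence the
    law depends on the Gram matrix only ([law_lin_gram]), provided that the law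
    of [Z] is invariant under reflections ([std_normal_householder]).

    The density of [Z] is a function of its norm, so this reduces to the
    invariance of Lebesgue measure under reflections, which is proved by induction on
    the dimension ([lebesgue_int_householder]): when the axis [w] is not orthogonal to
    the first basis vector, the shear that sends the first basis vector to a multiple
    of [w] turns the reflection into a map [(x, y) |-> (c y - x, y)]; both shears
    and such maps preserve Lebesgue measure by the theorem of Fubini and the
    one-dimensional case. *)

(** * Lebesgue and Gaussian integrals on the line *)

Section line.
Context {R : realType}.
Local Notation leb := (@lebesgue_measure R).
Local Notation N01 := (normal_prob (0 : R) 1).
Local Notation phi := (normal_pdf (0 : R) 1).

Lemma lebesgue_translation (a : R) (f : R -> \bar R) :
  measurable_fun [set: R] f -> (forall x, 0 <= f x)%E ->
  (\int[leb]_x f (x + a)%R = \int[leb]_x f x)%E.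
Proof.
move=> mf f0.
pose T (x : measurableTypeR R) : measurableTypeR R := (x + a)%R.
have mT : measurable_fun setT T.
  exact: measurable_funD.
transitivity (\int[pushforward leb T]_x f x)%E.
  by rewrite (ge0_integral_pushforward mT).
apply: eq_measure_integral => /= A mA _; apply/esym.
apply: (@lebesgue_measure_unique R (pushforward leb T)) => // _ [[b c] /= _ <-].
rewrite /pushforward (_ : _ @^-1` _ = `]b - a, c - a]%classic); last first.
  by apply/seteqP; split => x /=; rewrite !in_itv/= ltrBlDr lerBrDr.
rewrite !lebesgue_measure_itv/= !lte_fin ltrD2r.
by case: ifP => // _; rewrite -!EFinB; congr EFin; ring.
Qed.

Lemma lebesgue_reflection (a : R) (f : R -> \bar R) :
  measurable_fun [set: R] f -> (forall x, 0 <= f x)%E ->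
  (\int[leb]_x f (a - x)%R = \int[leb]_x f x)%E.
Proof.
move=> mf f0.
pose T (x : measurableTypeR R) : measurableTypeR R := (a - x)%R.
have mT : measurable_fun setT T.
  exact: measurable_funB.
transitivity (\int[pushforward leb T]_x f x)%E.
  by rewrite (ge0_integral_pushforward mT).
apply: eq_measure_integral => /= A mA _; apply/esym.
apply: (@lebesgue_measure_unique R (pushforward leb T)) => // _ [[b c] /= _ <-].
rewrite /pushforward (_ : _ @^-1` _ = `[a - c, a - b[%classic); last first.
  by apply/seteqP; split => x /=;
    rewrite /T !in_itv/= !(lerBlDr, ltrBrDr) ![_ + x]addrC andbC.
rewrite !lebesgue_measure_itv/= !lte_fin ltrD2l ltrN2.
by case: ifP => // _; rewrite -!EFinB; congr EFin; ring.
Qed.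

Lemma integral_normal_prob (f : R -> \bar R) :
  measurable_fun [set: R] f -> (forall x, 0 <= f x)%E ->
  (\int[N01]_x f x = \int[leb]_x (f x * (phi x)%:E))%E.
Proof.
move=> mf f0.
have dom := normal_prob_dominates (0 : R) 1.
rewrite -(Radon_Nikodym_SigmaFinite.change_of_variables dom)//.
have mphi : measurable_fun setT (EFin \o phi).
  by apply/measurable_EFinP; exact: measurable_normal_pdf.
apply: ae_eq_integral => //.
- apply: emeasurable_funM => //.
  by apply: (measurable_int leb); exact: Radon_Nikodym_SigmaFinite.f_integrable.
- exact: emeasurable_funM.
- apply: ae_eqe_mul2l; apply: integral_ae_eq => //=.
  + exact: Radon_Nikodym_SigmaFinite.f_integrable.
  + by move=> E _ mE; rewrite -Radon_Nikodym_SigmaFinite.f_integral.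
Qed.

Lemma std_normal_pdfE (x : R) : phi x = normal_peak 1 * expR (- x ^+ 2 / 2).
Proof. by rewrite normal_pdfE ?oner_eq0// /normal_fun subr0 expr1n. Qed.

Lemma std_normal_pdf_gt0 (x : R) : 0 < phi x.
Proof. by rewrite std_normal_pdfE mulr_gt0 ?expR_gt0 ?normal_peak_gt0 ?oner_eq0. Qed.

Lemma measurable_phiV : measurable_fun [set: R] (fun x => (phi x)^-1).
Proof.
rewrite (_ : (fun x => (phi x)^-1) = fun x => (normal_peak 1)^-1 * expR (x ^+ 2 / 2)).
  apply: measurable_funM => //; apply: measurableT_comp => //.
  exact: measurable_funM.
by apply/funext => x; rewrite std_normal_pdfE invfM -expRN mulNr opprK.
Qed.

Lemma lebesgue_normal (f : R -> \bar R) :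
  measurable_fun [set: R] f -> (forall x, 0 <= f x)%E ->
  (\int[N01]_x (f x * ((phi x)^-1)%:E) = \int[leb]_x f x)%E.
Proof.
move=> mf f0; rewrite integral_normal_prob.
- apply: eq_integral => x _; rewrite -muleA -EFinM mulVf ?mule1//.
  by rewrite gt_eqF ?std_normal_pdf_gt0.
- apply: emeasurable_funM => //; apply/measurable_EFinP.
  exact: measurable_phiV.
- by move=> x; rewrite mule_ge0// lee_fin invr_ge0 normal_pdf_ge0.
Qed.

Lemma phi_cvg0 : phi x @[x --> +oo] --> (0 : R).
Proof.
apply: (@squeeze_cvgr _ _ _ _ (cst 0) (fun x => normal_peak 1 * expR (- x))).
- near=> x.
  (* beyond 2, x ^+ 2 / 2 dominates x *)
  have x2 : 2 <= x by near: x; apply: nbhs_pinfty_ge; rewrite num_real.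
  rewrite std_normal_pdfE mulr_ge0 ?expR_ge0 ?normal_peak_ge0//=.
  rewrite ler_wpM2l ?normal_peak_ge0// ler_expR mulNr lerN2.
  rewrite ler_pdivlMr// expr2; nra.
- exact: cvg_cst.
- rewrite -[X in _ --> X](mulr0 (normal_peak 1)).
  by apply: cvgM; [exact: cvg_cst|exact: cvgr_expR].
Unshelve. all: by end_near. Qed.

Lemma is_derive_phi (x : R) : is_derive x 1 (fun y => - phi y) (x * phi x).
Proof.
rewrite (_ : (fun y => - phi y) =
    fun y => - (normal_peak 1 * expR (- y ^+ 2 / 2))); last first.
  by apply/funext => y; rewrite std_normal_pdfE.
rewrite std_normal_pdfE.
apply: is_derive_eq.
rewrite /GRing.scale/=.
by move: (expR _) => e; field.
Qed.

Lemma continuous_phi : continuous phi.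
Proof. by apply: continuous_normal_pdf; exact: oner_neq0. Qed.

Lemma integral_tail_phi (t : R) : 0 <= t ->
  (\int[leb]_(x in `[t, +oo[) (x * phi x)%:E = (phi t)%:E)%E.
Proof.
move=> t0.
rewrite (@ge0_continuous_FTC2y _ _ (fun x => - phi x) _ 0)//.
- by rewrite EFinN sub0e oppeK.
- by move=> x tx; rewrite mulr_ge0 ?normal_pdf_ge0// (le_trans t0).
- apply: continuous_subspaceT => x; apply: continuousM => //; exact: continuous_phi.
- by rewrite -[X in _ --> X]oppr0; apply: cvgN; exact: phi_cvg0.
- by move=> x _; have [] := is_derive_phi x.
- apply: cvg_at_right_filter; apply: cvgN; exact: continuous_phi.
- by move=> x _; rewrite derive1E; have [_ ->] := is_derive_phi x.
Qed.

(** Half of the integral is the integral over [0 <= x] of [x * (x * phi x)], where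
    the first factor is the length of [0, x]; exchanging the integrals leaves the
    tail integral [integral_tail_phi], that is, [phi] itself, whose integral over the
    half-line is also one half. *)
Lemma normal_second_moment : (\int[N01]_x (x ^+ 2)%:E = 1)%E.
Proof.
have mphi : measurable_fun [set: R] phi by exact: measurable_normal_pdf.
rewrite integral_normal_prob; first last.
- by move=> x; rewrite lee_fin sqr_ge0.
- by apply/measurable_EFinP.
have phi_even (x : R) : phi (- x) = phi x by rewrite !std_normal_pdfE sqrrN.
have cphi : continuous phi by exact: continuous_phi.
pose D : set R := `[0, +oo[%classic.
have DE : [set x : R | 0 <= x] = D by rewrite /D set_itvcy.
have mD : measurable D by exact: measurable_itv.
suff half : (\int[leb]_(x in D) (x ^+ 2 * phi x)%:E =
             \int[leb]_(x in D) (phi x)%:E)%E.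
  under eq_integral do rewrite -EFinM.
  rewrite ge0_symfun_integralT; first last.
  - by move=> x/=; rewrite phi_even sqrrN.
  - by move=> x; apply: cvgM; [exact: exprn_continuous|exact: cphi].
  - by move=> x; rewrite mulr_ge0 ?sqr_ge0 ?normal_pdf_ge0.
  rewrite DE half -DE -ge0_symfun_integralT ?integral_normal_pdf//.
  + by move=> x; exact: normal_pdf_ge0.
  + by move=> x; rewrite /= phi_even.
pose h (p : measurableTypeR R * measurableTypeR R) :=
  (if (0 <= p.1) && (p.1 <= p.2) then p.2 * phi p.2 else 0)%:E.
have h0 p : (0 <= h p)%E.
  rewrite /h lee_fin; case: ifP => // /andP[p0 p1].
  by rewrite mulr_ge0 ?normal_pdf_ge0// (le_trans p0).
have mh : measurable_fun setT h.
  apply/measurable_EFinP/measurable_fun_ifT => //=.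
  - by apply: measurable_and; exact: measurable_fun_ler.
  - by apply: measurable_funM => //; exact: measurableT_comp.
transitivity (\int[leb]_x \int[leb]_t h (t, x))%E.
  rewrite integral_mkcond; apply: eq_integral => x _; rewrite patchE.
  transitivity (\int[leb]_(t in `[0%R, x]) (x * phi x)%:E)%E.
    rewrite integral_cst//= lebesgue_measure_itv/= lte_fin /D mem_setE in_itv/= andbT.
    case: (ltgtP 0 x) => [x0|x0|<-]; rewrite ?mule0 ?expr0n ?mul0r//.
    by rewrite -EFinB -EFinM subr0 expr2 mulrAC.
  rewrite integral_mkcond; apply: eq_integral => t _.
  by rewrite patchE mem_setE in_itv/= /h/=; case: ifP.
rewrite -(@fubini_tonelli _ _ _ _ _ leb leb h mh h0).
rewrite [RHS]integral_mkcond; apply: eq_integral => t _; rewrite patchE.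
rewrite /D mem_setE in_itv/= andbT /h/=; case: (leP 0 t) => [t0|t0] /=; last first.
  by rewrite integral0_eq.
rewrite -integral_tail_phi// [in RHS]integral_mkcond; apply: eq_integral => x _.
by rewrite patchE mem_setE in_itv/= andbT; case: ifP.
Qed.

End line.

(** * The standard Gaussian measure and the Lebesgue integral on tuples *)

Section tuples.
Context {R : realType}.
Local Notation leb := (@lebesgue_measure R).
Local Notation N01 := (normal_prob (0 : R) 1).
Local Notation phi := (normal_pdf (0 : R) 1).

(** The first component is a [measurableTypeR R], the type that carries Lebesgue
    measure and the normal law, so that product measures with them are defined. *)
Definition tuple_cons n (p : measurableTypeR R * n.-tuple R) : n.+1.-tuple R :=
  [the n.+1.-tuple R of p.1 :: p.2].

Lemma measurable_tuple_cons n : measurable_fun setT (@tuple_cons n).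
Proof. by apply: measurable_cons => //; exact: measurable_fst. Qed.

HB.instance Definition _ n :=
  isMeasurableFun.Build _ _ _ _ (@tuple_cons n) (@measurable_tuple_cons n).

Fixpoint std_normal n : probability (n.-tuple R) R :=
  if n is m.+1 then distribution (N01 \x std_normal m)%E (@tuple_cons m)
  else dirac [tuple].

Lemma std_normalS n (f : n.+1.-tuple R -> \bar R) :
  measurable_fun [set: n.+1.-tuple R] f -> (forall z, 0 <= f z)%E ->
  (\int[std_normal n.+1]_z f z =
   \int[N01]_x \int[std_normal n]_z f (tuple_cons (x, z)))%E.
Proof.
move=> mf f0; rewrite ge0_integral_distribution//.
by rewrite (fubini_tonelli1 (f \o @tuple_cons n))//=; exact: measurableT_comp.
Qed.

Definition inv_density n (z : n.-tuple R) : R := \prod_(i < n) (phi (tnth z i))^-1.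

Lemma inv_density_ge0 n (z : n.-tuple R) : 0 <= inv_density z.
Proof. by apply: prodr_ge0 => i _; rewrite invr_ge0 normal_pdf_ge0. Qed.

Lemma measurable_inv_density n : measurable_fun [set: n.-tuple R] (@inv_density n).
Proof.
apply: (@measurable_prod _ _ _ _ _ _ 
  (fun i (z : n.-tuple R) => (phi (tnth z i))^-1)) => i _.
exact: (measurableT_comp measurable_phiV (@measurable_tnth _ R n i)).
Qed.

Lemma inv_density_cons n x (z : n.-tuple R) :
  inv_density (tuple_cons (x, z)) = (phi x)^-1 * inv_density z.
Proof.
rewrite /inv_density big_ord_recl tnth0; congr (_ * _).
by apply: eq_bigr => i _; rewrite tnthS.
Qed.

(** The Lebesgue integral on [R^n], written as a Gaussian integral against the
    inverse of the density: all the measures on tuples are then probabilities. *)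
Definition lebesgue_int n (f : n.-tuple R -> \bar R) : \bar R :=
  (\int[std_normal n]_z (f z * (inv_density z)%:E))%E.

Lemma lebesgue_int_ge0 n (f : n.-tuple R -> \bar R) :
  (forall z, 0 <= f z)%E -> (0 <= lebesgue_int f)%E.
Proof.
move=> f0; apply: integral_ge0 => z _.
by apply: mule_ge0; [exact: f0|rewrite lee_fin inv_density_ge0].
Qed.

Lemma measurable_weight d (T : measurableType d) n (g : T * n.-tuple R -> \bar R) :
  measurable_fun setT g ->
  measurable_fun setT (fun p => g p * (inv_density p.2)%:E)%E.
Proof.
move=> mg; apply: emeasurable_funM => //; apply/measurable_EFinP.
exact: (measurableT_comp (@measurable_inv_density n)).
Qed.

Lemma measurable_lebesgue_int d (T : measurableType d) n
    (g : T * n.-tuple R -> \bar R) :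
  measurable_fun setT g -> (forall p, 0 <= g p)%E ->
  measurable_fun [set: T] (fun x => lebesgue_int (fun z => g (x, z))).
Proof.
move=> mg g0; apply: (@measurable_fun_fubini_tonelli_F _ _ _ _ _ (std_normal n)
  (fun p => g p * (inv_density p.2)%:E)%E); first exact: measurable_weight.
by move=> p; apply: mule_ge0; [exact: g0|rewrite lee_fin inv_density_ge0].
Qed.

Lemma lebesgue_int_fubini d (T : measurableType d) n
    (g : T * n.-tuple R -> \bar R) (m : {sigma_finite_measure set T -> \bar R}) :
  measurable_fun setT g -> (forall p, 0 <= g p)%E ->
  (\int[m]_x lebesgue_int (fun z => g (x, z)) =
   lebesgue_int (fun z => \int[m]_x g (x, z)))%E.
Proof.
move=> mg g0; pose h (p : T * n.-tuple R) := (g p * (inv_density p.2)%:E)%E.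
have h0 p : (0 <= h p)%E.
  by apply: mule_ge0; [exact: g0|rewrite lee_fin inv_density_ge0].
transitivity (\int[std_normal n]_z \int[m]_x h (x, z))%E.
  exact: (@fubini_tonelli _ _ _ _ _ m (std_normal n) h (measurable_weight mg) h0).
apply: eq_integral => z _; rewrite -ge0_integralZr//.
- exact: measurableT_comp.
- by rewrite lee_fin inv_density_ge0.
Qed.

Lemma lebesgue_intS n (f : n.+1.-tuple R -> \bar R) :
  measurable_fun [set: n.+1.-tuple R] f -> (forall z, 0 <= f z)%E ->
  (lebesgue_int f = \int[leb]_x lebesgue_int (fun z => f (tuple_cons (x, z))))%E.
Proof.
move=> mf f0.
have mfc : measurable_fun setT (f \o @tuple_cons n) by exact: measurableT_comp.
rewrite {1}/lebesgue_int std_normalS; first last.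
- by move=> z; apply: mule_ge0; [exact: f0|rewrite lee_fin inv_density_ge0].
- apply: emeasurable_funM => //; apply/measurable_EFinP.
  exact: measurable_inv_density.
rewrite -lebesgue_normal; first last.
- by move=> x; exact: lebesgue_int_ge0.
- by apply: (measurable_lebesgue_int mfc) => p; exact: f0.
apply: eq_integral => x _; rewrite -ge0_integralZr//.
- apply: eq_integral => z _.
  by rewrite inv_density_cons EFinM -muleA [X in (_ * X)%E]muleC.
- apply: emeasurable_funM; first exact: (measurableT_comp mfc).
  by apply/measurable_EFinP; exact: measurable_inv_density.
- by move=> z _; apply: mule_ge0; [exact: f0|rewrite lee_fin inv_density_ge0].
- by rewrite lee_fin invr_ge0 normal_pdf_ge0.
Qed.

Lemma measurable_box n (B : 'I_n -> set R) : (forall i, measurable (B i)) ->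
  measurable [set z : n.-tuple R | forall i, B i (tnth z i)].
Proof.
move=> mB.
rewrite (_ : [set _ | _] =
    \bigcap_(i in [set: 'I_n]) [set z : n.-tuple R | B i (tnth z i)]).
  apply: fin_bigcap_measurable => // i _.
  by have := @measurable_tnth _ R n i measurableT _ (mB i); rewrite setTI.
by apply/seteqP; split => z /= h i; [move=> _; exact: h|exact: h].
Qed.

Lemma std_normal_gaussian n : std_gaussian (std_normal n).
Proof.
elim: n => [|n IH] B mB.
  by rewrite /= big_ord0 diracE mem_set//= => -[].
rewrite big_ord_recl /= /distribution /pushforward.
rewrite -(IH (fun i => B (lift ord0 i)))//.
rewrite -product_measure1E; first last.
- exact: (measurable_box (fun i => mB (lift ord0 i))).
- exact: mB.
congr (_ _); apply/seteqP; split => -[x z] /=.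
- move=> h; split => [|i]; first by have := h ord0; rewrite tnth0.
  by have := h (lift ord0 i); rewrite tnthS.
- move=> [Bx Bz] i; case: (unliftP ord0 i) => [j ->|->]; first by rewrite tnthS.
  by rewrite tnth0.
Qed.

(** Boxes are stable under intersection and generate the measurable sets. *)
Lemma std_gaussian_unique n (g h : probability (n.-tuple R) R) :
  std_gaussian g -> std_gaussian h ->
  forall A, measurable A -> g A = h A.
Proof.
move=> sg sh A mA.
pose G := [set C : set (n.-tuple R) |
  exists2 B : 'I_n -> set R, (forall i, measurable (B i)) &
    C = [set z | forall i, B i (tnth z i)]].
apply: (measure_unique G (fun=> setT)) => //.
- apply/seteqP; split.
    apply: smallest_sub; first exact: smallest_sigma_algebra.
    rewrite -bigcup_seq => _ [i /= _ [C mC <-]]; rewrite setTI.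
    apply: sub_sigma_algebra; exists (fun j => if j == i then C else setT).
      by move=> j; case: ifP.
    apply/seteqP; split => z /=; first by move=> Cz j; case: eqP => // ->.
    by move/(_ i); rewrite eqxx.
  apply: smallest_sub; first exact: sigma_algebra_measurable.
  by move=> _ [B mB ->]; exact: measurable_box.
- move=> _ _ [B1 mB1 ->] [B2 mB2 ->]; exists (fun i => B1 i `&` B2 i).
    by move=> i; exact: measurableI.
  apply/seteqP; split => z /=; first by move=> [h1 h2] i; split.
  by move=> h12; split => i; have [] := h12 i.
- by move=> _; exists (fun=> setT) => //; apply/seteqP; split.
- by rewrite bigcup_const.
- by move=> _ [B mB ->]; exact: (etrans (sg B mB) (esym (sh B mB))).
- by move=> _; rewrite ltey_eq fin_num_measure.
Qed.

End tuples.

(** * Reflections *)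

Section reflections.
Context {R : realType}.
Local Notation leb := (@lebesgue_measure R).
Local Notation phi := (normal_pdf (0 : R) 1).

Lemma measurable_mktuple d (T : measurableType d) n (F : 'I_n -> T -> R) :
  (forall i, measurable_fun [set: T] (F i)) ->
  measurable_fun [set: T] (fun x => [tuple F i x | i < n]).
Proof.
move=> mF; apply/measurable_fun_tnthP => i.
rewrite (_ : _ \o _ = F i)//; apply/funext => x /=; exact: tnth_mktuple.
Qed.

Definition translate n (a : 'I_n -> R) (z : n.-tuple R) : n.-tuple R :=
  [tuple tnth z i + a i | i < n].

Lemma measurable_translate n (a : 'I_n -> R) :
  measurable_fun [set: n.-tuple R] (translate a).
Proof.
apply: measurable_mktuple => i; apply: measurable_funD => //.
exact: measurable_tnth.
Qed.

Lemma translate_cons n (a : 'I_n.+1 -> R) x (z : n.-tuple R) :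
  translate a (tuple_cons (x, z)) =
  tuple_cons (x + a ord0, translate (fun i => a (lift ord0 i)) z).
Proof.
apply: eq_from_tnth => i; rewrite tnth_mktuple.
by case: (unliftP ord0 i) => [j ->|->]; rewrite ?tnthS ?tnth0 ?tnth_mktuple.
Qed.

Lemma lebesgue_int_translate n (a : 'I_n -> R) (f : n.-tuple R -> \bar R) :
  measurable_fun [set: n.-tuple R] f -> (forall z, 0 <= f z)%E ->
  lebesgue_int (fun z => f (translate a z)) = lebesgue_int f.
Proof.
elim: n => [|n IH] in a f *; move=> mf f0.
  by congr lebesgue_int; apply/funext => z; congr f; rewrite tuple0 [RHS]tuple0.
have mfc : measurable_fun setT (f \o @tuple_cons R n) by exact: measurableT_comp.
rewrite lebesgue_intS//; last exact: measurableT_comp (measurable_translate a).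
rewrite [RHS]lebesgue_intS//.
under eq_integral => x _ do under eq_fun do rewrite translate_cons.
rewrite -[RHS](lebesgue_translation (a ord0)); first last.
- by move=> x; exact: lebesgue_int_ge0.
- by apply: (measurable_lebesgue_int mfc) => p; exact: f0.
apply: eq_integral => x _.
apply: (IH _ (fun z => f (tuple_cons (x + a ord0, z)))) => //.
exact: (measurableT_comp mfc).
Qed.

Definition dot n (u v : 'I_n -> R) : R := \sum_i u i * v i.

Lemma dotC n (u v : 'I_n -> R) : dot u v = dot v u.
Proof. by apply: eq_bigr => i _; rewrite mulrC. Qed.

Lemma dotDr n (u v w : 'I_n -> R) : dot u (v \+ w) = dot u v + dot u w.
Proof. by rewrite /dot -big_split; apply: eq_bigr => i _; rewrite mulrDr. Qed.

Lemma dotDl n (u v w : 'I_n -> R) : dot (u \+ v) w = dot u w + dot v w.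
Proof. by rewrite dotC dotDr !(dotC w). Qed.

Lemma dotZr n (u v : 'I_n -> R) c : dot u (fun i => c * v i) = c * dot u v.
Proof. by rewrite /dot mulr_sumr; apply: eq_bigr => i _; rewrite mulrCA. Qed.

Lemma dotBl n (u v w : 'I_n -> R) : dot (u \- v) w = dot u w - dot v w.
Proof. by rewrite /dot -sumrB; apply: eq_bigr => i _; rewrite mulrBl. Qed.

Lemma dotBr n (u v w : 'I_n -> R) : dot u (v \- w) = dot u v - dot u w.
Proof. by rewrite dotC dotBl !(dotC u). Qed.

Lemma dot0l n (u : 'I_n -> R) : dot (fun=> 0) u = 0.
Proof. by rewrite /dot big1// => i _; rewrite mul0r. Qed.

Lemma dot0r n (u : 'I_n -> R) : dot u (fun=> 0) = 0.
Proof. by rewrite dotC dot0l. Qed.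

Lemma dot_ge0 n (u : 'I_n -> R) : 0 <= dot u u.
Proof. by apply: sumr_ge0 => i _; rewrite -expr2 sqr_ge0. Qed.

Lemma dot_eq0 n (u : 'I_n -> R) : dot u u = 0 -> u = fun=> 0.
Proof.
move=> /eqP; rewrite psumr_eq0; last by move=> i _; rewrite -expr2 sqr_ge0.
move=> /allP u0; apply/funext => i; have := u0 i (mem_index_enum _).
by rewrite /= mulf_eq0 orbb => /eqP.
Qed.

Lemma dotS n (u v : 'I_n.+1 -> R) :
  dot u v = u ord0 * v ord0 + dot (fun i => u (lift ord0 i)) (fun i => v (lift ord0 i)).
Proof. exact: big_ord_recl. Qed.

Definition vec_cons n x (v : 'I_n -> R) (i : 'I_n.+1) : R :=
  if unlift ord0 i is Some j then v j else x.

Lemma dot_vec_consl n x (v : 'I_n -> R) (u : 'I_n.+1 -> R) :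
  dot (vec_cons x v) u = x * u ord0 + dot v (fun i => u (lift ord0 i)).
Proof.
rewrite dotS /vec_cons unlift_none; congr (_ + dot _ _).
by apply/funext => i; rewrite liftK.
Qed.

Lemma dot_vec_cons n x y (v w : 'I_n -> R) :
  dot (vec_cons x v) (vec_cons y w) = x * y + dot v w.
Proof.
rewrite dot_vec_consl /vec_cons unlift_none; congr (_ + dot _ _).
by apply/funext => i; rewrite liftK.
Qed.

Lemma dot_cons n (u : 'I_n.+1 -> R) x (z : n.-tuple R) :
  dot u (tnth (tuple_cons (x, z))) =
  u ord0 * x + dot (fun i => u (lift ord0 i)) (tnth z).
Proof. by rewrite dotS; congr (_ + dot _ _); apply/funext => i; rewrite tnthS. Qed.

Lemma measurable_dot n (u : 'I_n -> R) :
  measurable_fun [set: n.-tuple R] (fun z => dot u (tnth z)).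
Proof.
apply: (@measurable_sum _ _ _ _ _ _ (fun i (z : n.-tuple R) => u i * tnth z i)) => i.
by apply: measurable_funM => //; exact: measurable_tnth.
Qed.

(** The reflection along [w]; for [w = 0] the convention [0^-1 = 0] makes it the
    identity. *)
Definition householder n (w u : 'I_n -> R) : 'I_n -> R :=
  fun i => u i - 2 * dot w u / dot w w * w i.

Lemma dot_householderl n (w u v : 'I_n -> R) :
  dot (householder w u) v = dot u v - 2 * dot w u * dot w v / dot w w.
Proof.
transitivity (dot (u \- (fun i => 2 * dot w u / dot w w * w i)) v) => //.
by rewrite dotBl [X in _ - X]dotC dotZr [dot v w]dotC mulrAC.
Qed.

Lemma dot_householderr n (w u v : 'I_n -> R) :
  dot u (householder w v) = dot (householder w u) v.
Proof. by rewrite dotC !dot_householderl dotC [2 * _ * _]mulrAC. Qed.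

Lemma dot_householder n (w u v : 'I_n -> R) :
  dot (householder w u) (householder w v) = dot u v.
Proof.
rewrite dot_householderl dot_householderr !dot_householderl.
rewrite dot_householderr dot_householderl.
have [->|w0] := eqVneq (dot w w) 0; first by rewrite invr0 !mulr0 !subr0.
by field.
Qed.

Lemma householder_orth n (w u : 'I_n -> R) : dot w u = 0 -> householder w u = u.
Proof.
by move=> wu; apply/funext => i; rewrite /householder wu mulr0 !mul0r subr0.
Qed.

Lemma householder_swap n (u v : 'I_n -> R) :
  dot u u = dot v v -> householder (u \- v) u = v.
Proof.
move=> uv; have [E|E] := eqVneq (dot (u \- v) (u \- v)) 0.
  have {}E := dot_eq0 E; rewrite householder_orth.
    apply/funext => i; apply/eqP; rewrite -subr_eq0.
    by have /(congr1 (fun h => h i))/= -> := E.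
  by rewrite E /dot big1// => i _; rewrite mul0r.
have H : dot (u \- v) (u \- v) = 2 * dot (u \- v) u.
  by rewrite dotBr !dotBl -uv (dotC v u); ring.
apply/funext => i; rewrite /householder -H divff// mul1r /=; ring.
Qed.

Definition tuple_householder n (w : 'I_n -> R) (z : n.-tuple R) : n.-tuple R :=
  [tuple householder w (tnth z) i | i < n].

Lemma tnth_householder n (w : 'I_n -> R) (z : n.-tuple R) :
  tnth (tuple_householder w z) = householder w (tnth z).
Proof. by apply/funext => i; rewrite tnth_mktuple. Qed.

Lemma measurable_tuple_householder n (w : 'I_n -> R) :
  measurable_fun [set: n.-tuple R] (tuple_householder w).
Proof.
apply: measurable_mktuple => i; apply: measurable_funB; first exact: measurable_tnth.
do 2 apply: measurable_funM => //.
apply: measurable_funM => //; exact: measurable_dot.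
Qed.

Lemma householder_cons0 n (w : 'I_n.+1 -> R) x z : w ord0 = 0 ->
  tuple_householder w (tuple_cons (x, z)) =
  tuple_cons (x, tuple_householder (fun i => w (lift ord0 i)) z).
Proof.
move=> w0; apply: eq_from_tnth => i.
rewrite tnth_mktuple /householder dot_cons [dot w w]dotS w0 !mul0r !add0r.
case: (unliftP ord0 i) => [j ->|->]; rewrite ?tnthS ?tnth_mktuple//.
by rewrite !tnth0 w0 mulr0 subr0.
Qed.

(** The point [(x, y + x w' / w_0)] is [(0, y) + (x / w_0) w], and a reflection along
    [w] moves points along [w]: in these coordinates it only changes [x]. *)
Lemma householder_cons n (w : 'I_n.+1 -> R) x (y : n.-tuple R) :
  w ord0 != 0 ->
  let w' i := w (lift ord0 i) in
  let a t i := t * (w' i / w ord0) in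
  let x' := - (2 * w ord0 * dot w' (tnth y) / dot w w) - x in
  tuple_householder w (tuple_cons (x, translate (a x) y)) =
  tuple_cons (x', translate (a x') y).
Proof.
move=> w0 w' a x'.
have sw : dot w w = w ord0 ^+ 2 + dot w' w' by rewrite dotS.
have sw0 : dot w w != 0.
  by rewrite sw gt_eqF// ltr_wpDr ?exprn_even_gt0// dot_ge0.
have E : dot w (tnth (tuple_cons (x, translate (a x) y))) =
         x * dot w w / w ord0 + dot w' (tnth y).
  rewrite dot_cons -/w'.
  have -> : tnth (translate (a x) y) = tnth y \+ (fun i => x / w ord0 * w' i).
    by apply/funext => i; rewrite tnth_mktuple /a; congr (_ + _); field.
  by rewrite dotDr dotZr sw; field.
apply: eq_from_tnth => i; rewrite tnth_mktuple /householder E /x'.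
case: (unliftP ord0 i) => [j ->|->]; rewrite ?tnthS ?tnth0 ?tnth_mktuple.
  by rewrite /a -/(w' j); field; exact/andP.
by rewrite /=; field; exact/andP.
Qed.

(** If [w] has first coordinate 0, the reflection acts on the other coordinates
    only; otherwise it is conjugated by a shear to a reflection of the first coordinate
    that depends on the others. *)
Lemma lebesgue_int_householder n (w : 'I_n -> R) (f : n.-tuple R -> \bar R) :
  measurable_fun [set: n.-tuple R] f -> (forall z, 0 <= f z)%E ->
  lebesgue_int (fun z => f (tuple_householder w z)) = lebesgue_int f.
Proof.
elim: n => [|n IH] in w f *; move=> mf f0.
  by congr lebesgue_int; apply/funext => z; congr f; rewrite tuple0 [RHS]tuple0.
have mfc : measurable_fun setT (f \o @tuple_cons R n) by exact: measurableT_comp.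
have mfr : measurable_fun setT (f \o tuple_householder w).
  exact: measurableT_comp (measurable_tuple_householder w).
rewrite lebesgue_intS// [RHS]lebesgue_intS//.
have [w0|w0] := eqVneq (w ord0) 0.
  apply: eq_integral => x _; under eq_fun do rewrite householder_cons0//.
  apply: (IH _ (fun z => f (tuple_cons (x, z)))) => //.
  exact: (measurableT_comp mfc).
pose w' i := w (lift ord0 i).
pose a t i := t * (w' i / w ord0).
pose c y := - (2 * w ord0 * dot w' (tnth y) / dot w w).
pose g (p : measurableTypeR R * n.-tuple R) :=
  f (tuple_cons (p.1, translate (a p.1) p.2)).
have shear (h : n.+1.-tuple R -> \bar R) :
    measurable_fun setT h -> (forall z, 0 <= h z)%E ->
  (\int[leb]_x lebesgue_int (fun z => h (tuple_cons (x, z))) =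
   \int[leb]_x lebesgue_int (fun y => h (tuple_cons (x, translate (a x) y))))%E.
  move=> mh h0; apply: eq_integral => x _.
  rewrite (lebesgue_int_translate (a x)
    (f := fun z => h (tuple_cons (x, z))))//.
  exact: (measurableT_comp
    (measurableT_comp mh (@measurable_tuple_cons R n))).
rewrite [RHS]shear//.
transitivity (\int[leb]_x lebesgue_int (fun y =>
    f (tuple_householder w (tuple_cons (x, translate (a x) y)))))%E.
  by apply: (shear (f \o tuple_householder w)) => // z; exact: f0.
under eq_integral => x _ do under eq_fun do rewrite householder_cons//.
have mtnth i : measurable_fun setT
    (fun p : measurableTypeR R * n.-tuple R => tnth p.2 i).
  exact: (measurableT_comp (@measurable_tnth _ R n i) measurable_snd).
have mg : measurable_fun setT g.
  apply: (measurableT_comp mfc); apply: measurable_fun_pair => //=.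
  apply: measurable_mktuple => i; apply: measurable_funD; first exact: mtnth.
  by apply: measurable_funM => //; exact: measurable_fst.
have mc : measurable_fun setT c.
  apply: measurable_funN; apply: measurable_funM => //.
  by apply: measurable_funM => //; exact: measurable_dot.
pose g' (p : measurableTypeR R * n.-tuple R) := g (c p.2 - p.1, p.2).
have mg' : measurable_fun setT g'.
  apply: (measurableT_comp mg); apply: measurable_fun_pair => //=.
  apply: measurable_funB; last exact: measurable_fst.
  exact: (measurableT_comp mc measurable_snd).
have g0 p : (0 <= g p)%E by exact: f0.
have g'0 p : (0 <= g' p)%E by exact: f0.
(* for fixed y, the reflection becomes x |-> c y - x *)
rewrite (lebesgue_int_fubini leb mg g0) (lebesgue_int_fubini leb mg' g'0).
congr lebesgue_int; apply/funext => y.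
apply: (lebesgue_reflection (c y) (f := fun x => g (x, y))) => //.
exact: (measurableT_comp mg).
Qed.

Lemma inv_densityE n (z : n.-tuple R) :
  inv_density z = (normal_peak 1)^-1 ^+ n * expR (dot (tnth z) (tnth z) / 2).
Proof.
rewrite mulr_suml expR_sum -[n in _ ^+ n]card_ord -prodr_const -big_split/=.
by apply: eq_bigr => i _; rewrite std_normal_pdfE invfM -expRN mulNr opprK expr2.
Qed.

Lemma inv_density_householder n (w : 'I_n -> R) (z : n.-tuple R) :
  inv_density (tuple_householder w z) = inv_density z.
Proof. by rewrite !inv_densityE tnth_householder dot_householder. Qed.

(** The density depends on the norm only, which reflections preserve. *)
Lemma std_normal_householder n (w : 'I_n -> R) (f : n.-tuple R -> \bar R) :
  measurable_fun [set: n.-tuple R] f -> (forall z, 0 <= f z)%E ->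
  (\int[std_normal n]_z f (tuple_householder w z) = \int[std_normal n]_z f z)%E.
Proof.
move=> mf f0.
have density_gt0 z : 0 < inv_density z :> R.
  by apply: prodr_gt0 => i _; rewrite invr_gt0 std_normal_pdf_gt0.
pose h (z : n.-tuple R) := (f z * ((inv_density z)^-1)%:E)%E.
have hE z : (h z * (inv_density z)%:E = f z)%E.
  by rewrite /h -muleA -EFinM mulVf ?mule1// gt_eqF.
transitivity (lebesgue_int (fun z => h (tuple_householder w z))).
  by apply: eq_integral => z _; rewrite -[in RHS](inv_density_householder w) hE.
rewrite lebesgue_int_householder.
- by apply: eq_integral => z _; rewrite hE.
- apply: emeasurable_funM => //; apply/measurable_EFinP.
  under eq_fun do rewrite -prodfV.
  apply: (@measurable_prod _ _ _ _ _ _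
    (fun i (z : n.-tuple R) => (phi (tnth z i))^-1^-1)) => i _.
  under eq_fun do rewrite invrK.
  exact: (measurableT_comp (measurable_normal_pdf 0 1)
    (@measurable_tnth _ R n i)).
- by move=> z; apply: mule_ge0 => //; rewrite lee_fin invr_ge0 ltW.
Qed.

End reflections.

(** * Linear images of the standard Gaussian measure *)

Section linear_images.
Context {R : realType}.
Local Notation N01 := (normal_prob (0 : R) 1).

Definition lin n k (M : 'I_n -> 'I_k -> R) (z : k.-tuple R) : n.-tuple R :=
  [tuple dot (M i) (tnth z) | i < n].

Lemma measurable_lin n k (M : 'I_n -> 'I_k -> R) :
  measurable_fun [set: k.-tuple R] (lin M).
Proof. by apply: measurable_mktuple => i; exact: measurable_dot. Qed.

Lemma lin_householder n k (M : 'I_n -> 'I_k -> R) w z :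
  lin M (tuple_householder w z) = lin (fun i => householder w (M i)) z.
Proof.
by apply: eq_from_tnth => i; rewrite !tnth_mktuple tnth_householder dot_householderr.
Qed.

(** Turn [M] into [N] one row at a time, the last rows first: [householder_swap]
    corrects the row [i0], and the rows that are already equal are orthogonal to
    [M i0 - N i0] because the Gram matrices agree. *)
Lemma integral_lin_gram_sq n k (M N : 'I_n -> 'I_k -> R) (f : n.-tuple R -> \bar R) :
  measurable_fun [set: n.-tuple R] f -> (forall z, 0 <= f z)%E ->
  (forall i l, dot (M i) (M l) = dot (N i) (N l)) ->
  (\int[std_normal k]_z f (lin M z) = \int[std_normal k]_z f (lin N z))%E.
Proof.
move=> mf f0.
suff H d : (forall i l, dot (M i) (M l) = dot (N i) (N l)) ->
    (forall i : 'I_n, (d <= i)%N -> M i = N i) ->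
    (\int[std_normal k]_z f (lin M z) = \int[std_normal k]_z f (lin N z))%E.
  by move=> MN; apply: (H n) => // i; rewrite leqNgt ltn_ord.
elim: d M => [|d IH] M MN agree.
  by have -> : M = N by apply/funext => i; exact: agree.
have [nd|dn] := leqP n d.
  by apply: IH => // i di; have := leq_trans nd di; rewrite leqNgt ltn_ord.
pose i0 := Ordinal dn.
pose w := M i0 \- N i0.
transitivity (\int[std_normal k]_z f (lin (fun i => householder w (M i)) z))%E.
  rewrite -(std_normal_householder w (f := fun z => f (lin M z)))//.
    by apply: eq_integral => z _; rewrite lin_householder.
  exact: measurableT_comp (measurable_lin M).
apply: IH => [i l|i]; first by rewrite dot_householder.
rewrite leq_eqVlt => /orP[/eqP di|di].
  have -> : i = i0 by apply/val_inj.
  exact/householder_swap/MN.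
rewrite householder_orth ?agree//.
by rewrite dotBl -[in X in X - _](agree i di) MN subrr.
Qed.

(** Zero columns make it possible to compare images of spaces of different
    dimensions. *)
Lemma gram_pad n k p (M : 'I_n -> 'I_k -> R) (f : n.-tuple R -> \bar R) :
  measurable_fun [set: n.-tuple R] f -> (forall z, 0 <= f z)%E ->
  (k <= p)%N ->
  exists2 M' : 'I_n -> 'I_p -> R,
    forall i l, dot (M' i) (M' l) = dot (M i) (M l) &
    (\int[std_normal p]_z f (lin M' z) = \int[std_normal k]_z f (lin M z))%E.
Proof.
move=> mf f0; elim: p => [|p IH].
  by rewrite leqn0 => /eqP k0; subst k; exists M.
rewrite leq_eqVlt => /orP[/eqP kp|/IH[M' gM' lM']]; first by subst k; exists M.
pose M'' i := vec_cons 0 (M' i).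
exists M''.
  by move=> i l; rewrite dot_vec_cons mul0r add0r gM'.
rewrite std_normalS//; last exact: measurableT_comp (measurable_lin M'').
have E x z : lin M'' (tuple_cons (x, z)) = lin M' z.
  apply: eq_from_tnth => i; rewrite !tnth_mktuple dot_vec_consl mul0r add0r.
  by congr dot; apply/funext => j; rewrite tnthS.
under eq_integral => x _ do under eq_integral => z _ do rewrite E.
rewrite integral_cst//.
by rewrite [X in (_ * X)%E]probability_setT mule1.
Qed.

Lemma integral_lin_gram n k l (M : 'I_n -> 'I_k -> R) (N : 'I_n -> 'I_l -> R)
    (f : n.-tuple R -> \bar R) :
  measurable_fun [set: n.-tuple R] f -> (forall z, 0 <= f z)%E ->
  (forall i j, dot (M i) (M j) = dot (N i) (N j)) ->
  (\int[std_normal k]_z f (lin M z) = \int[std_normal l]_z f (lin N z))%E.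
Proof.
move=> mf f0 MN.
have [M' gM' <-] := gram_pad M mf f0 (leq_maxl k l).
have [N' gN' <-] := gram_pad N mf f0 (leq_maxr k l).
by apply: integral_lin_gram_sq => // i j; rewrite gM' gN'.
Qed.

Lemma law_lin_gram n k l (M : 'I_n -> 'I_k -> R) (N : 'I_n -> 'I_l -> R) :
  (forall i j, dot (M i) (M j) = dot (N i) (N j)) ->
  forall B, measurable B ->
    std_normal k (lin M @^-1` B) = std_normal l (lin N @^-1` B).
Proof.
move=> MN B mB.
have mpre m (K : 'I_n -> 'I_m -> R) : measurable (lin K @^-1` B).
  by rewrite -[X in measurable X]setTI; exact: measurable_lin.
have indicE m (K : 'I_n -> 'I_m -> R) :
    (std_normal m (lin K @^-1` B) =
     \int[std_normal m]_z (\1_B (lin K z))%:E)%E.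
  rewrite -[in LHS](setIT (lin K @^-1` B)) -integral_indic//; exact: mpre.
rewrite !indicE.
apply: (integral_lin_gram (f := fun z => (\1_B z)%:E)) => //.
by apply/measurable_EFinP; exact: measurable_indic.
Qed.

(** The law of [u . Z] is [N(0, |u|^2)]: the 1 x k matrix [u] and the 1 x 1 matrix
    [|u|] have the same Gram matrix. *)
Lemma integral_dot_norm k (u : 'I_k -> R) (f : R -> \bar R) :
  measurable_fun [set: R] f -> (forall x, 0 <= f x)%E ->
  (\int[std_normal k]_z f (dot u (tnth z)) =
   \int[N01]_x f (Num.sqrt (dot u u) * x)%R)%E.
Proof.
move=> mf f0.
pose M (_ : 'I_1) := u.
pose N (_ _ : 'I_1) := Num.sqrt (dot u u).
pose g (y : 1.-tuple R) := f (tnth y ord0).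
have mg : measurable_fun setT g.
  exact: measurableT_comp mf (@measurable_tnth _ R 1 ord0).
have := @integral_lin_gram _ _ _ M N g mg (fun=> f0 _).
rewrite /g/=; under eq_integral do rewrite tnth_mktuple.
move=> ->; last first.
  by move=> i j; rewrite /dot big_ord1 -expr2 sqr_sqrtr// dot_ge0.
rewrite std_normalS//; last exact: measurableT_comp mg (measurable_lin N).
apply: eq_integral => x _.
under eq_integral do rewrite tnth_mktuple dot_cons /dot big_ord0 addr0.
by rewrite integral_cst// [X in (_ * X)%E]probability_setT mule1.
Qed.

Lemma integral_dot_sqr k (u : 'I_k -> R) :
  (\int[std_normal k]_z (dot u (tnth z) ^+ 2)%:E = (dot u u)%:E)%E.
Proof.
rewrite (integral_dot_norm u (f := fun x => (x ^+ 2)%:E)); first last.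
- by move=> x; rewrite lee_fin sqr_ge0.
- by apply/measurable_EFinP.
under eq_integral do rewrite exprMn sqr_sqrtr ?dot_ge0// EFinM.
rewrite ge0_integralZl ?normal_second_moment ?mule1//.
- by apply/measurable_EFinP.
- by move=> x _; rewrite lee_fin sqr_ge0.
- by rewrite lee_fin dot_ge0.
Qed.

Lemma integrable_dot_sqr k (u : 'I_k -> R) :
  (std_normal k).-integrable setT (fun z => (dot u (tnth z) ^+ 2)%:E).
Proof.
apply/integrableP; split.
  by apply/measurable_EFinP; apply: measurable_funX; exact: measurable_dot.
under eq_integral do rewrite gee0_abs ?lee_fin ?sqr_ge0//.
by rewrite integral_dot_sqr ltry.
Qed.

Lemma integrable_dot k (u : 'I_k -> R) :
  (std_normal k).-integrable setT (fun z => (dot u (tnth z))%:E).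
Proof.
apply: (@le_integrable _ _ _ _ _ measurableT _
  (fun z => 1 + (dot u (tnth z) ^+ 2)%:E)%E).
- by apply/measurable_EFinP; exact: measurable_dot.
- move=> z _; rewrite -EFinD !abse_EFin lee_fin [leRHS]ger0_norm ?addr_ge0 ?sqr_ge0//.
  move: (dot _ _) => x; rewrite ler_norml; apply/andP.
  have := sqr_ge0 (x + 1); have := sqr_ge0 (x - 1); have := sqr_ge0 x.
  by split; nra.
- apply: integrableD => //; last exact: integrable_dot_sqr.
  exact: finite_measure_integrable_cst.
Qed.

(** [u . Z] and [- u . Z] have the same law, so the positive and negative parts of
    [u . Z] have the same integral. *)
Lemma integral_dot k (u : 'I_k -> R) :
  (\int[std_normal k]_z (dot u (tnth z))%:E = 0)%E.
Proof.
have mp : measurable_fun [set: R] (fun x => maxe x%:E 0).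
  by apply: measurable_maxe => //; exact/measurable_EFinP.
have uN : dot (\- u) (\- u) = dot u u by apply: eq_bigr => i _; rewrite mulrNN.
rewrite integralE.
have p0 x : (0 <= maxe x%:E 0 :> \bar R)%E by rewrite le_max lexx orbT.
have <- : (\int[std_normal k]_z (fun z => (dot u (tnth z))%:E)^\+ z =
          \int[std_normal k]_z (fun z => (dot u (tnth z))%:E)^\- z)%E.
  under eq_integral do rewrite funeposE; under [RHS]eq_integral do rewrite funenegE.
  have := integral_dot_norm (\- u) mp p0.
  rewrite uN -(integral_dot_norm u mp p0) => <-.
  apply: eq_integral => z _; congr (maxe _ _).
  by rewrite -EFinN /dot -sumrN; congr EFin; apply: eq_bigr => i _; rewrite mulNr.
rewrite subee//; apply: integrable_fin_num => //.
exact/integrable_funepos/integrable_dot.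
Qed.

(** Polarization of [integral_dot_sqr]. *)
Lemma integral_dot_dot k (u v : 'I_k -> R) :
  (std_normal k).-integrable setT
    (fun z => (dot u (tnth z) * dot v (tnth z))%:E) /\
  (\int[std_normal k]_z (dot u (tnth z) * dot v (tnth z))%:E = (dot u v)%:E)%E.
Proof.
have E : (fun z : k.-tuple R => (dot u (tnth z) * dot v (tnth z))%:E) =
  (fun z => 4^-1%:E * ((dot (u \+ v) (tnth z) ^+ 2)%:E -
                       (dot (u \- v) (tnth z) ^+ 2)%:E))%E.
  apply/funext => z; rewrite -EFinB -EFinM; congr EFin.
  by rewrite dotBl dotDl; field.
have i1 := integrable_dot_sqr (u \+ v).
have i2 := integrable_dot_sqr (u \- v).
have iB := integrableB measurableT i1 i2.
rewrite E; split; first exact: integrableZl.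
rewrite integralZl// integralB// !integral_dot_sqr -EFinB -EFinM; congr EFin.
by rewrite dotBl !dotBr dotDl !dotDr (dotC v u); field.
Qed.

(** The translation part of the affine map is the mean, hence 0, and the covariance
    is then the Gram matrix of the rows. *)
Lemma centered_gaussian_lin n (C : 'M[R]_n) (mu : probability (n.-tuple R) R) :
  centered_gaussian C mu ->
  exists k (A : 'I_n -> 'I_k -> R),
    (forall i j, dot (A i) (A j) = C i j) /\
    (forall B, measurable B -> mu B = std_normal k (lin A @^-1` B)).
Proof.
move=> [[k [A [b [g [sg muE]]]]] mean cov].
have affE z : affine A b z = translate (tnth b) (lin A z).
  by apply: eq_from_tnth => i; rewrite !tnth_mktuple.
have maff : measurable_fun setT (affine A b).
  rewrite (_ : affine A b = translate (tnth b) \o lin A); last exact/funext.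
  exact: measurableT_comp (measurable_translate _) (measurable_lin _).
have muE' B : measurable B -> mu B = std_normal k (affine A b @^-1` B).
  move=> mB; rewrite muE//.
  apply: std_gaussian_unique => //; first exact: std_normal_gaussian.
  by rewrite -[X in measurable X]setTI; exact: maff.
have transfer (f : n.-tuple R -> \bar R) : measurable_fun setT f ->
    (std_normal k).-integrable setT (f \o affine A b) ->
    (\int[mu]_x f x = \int[std_normal k]_z f (affine A b z))%E.
  move=> mf intf.
  transitivity (\int[pushforward (std_normal k) (affine A b)]_x f x)%E.
    by apply: eq_measure_integral => B mB _; exact: muE'.
  by rewrite (integral_pushforward maff).
have mcoor i : measurable_fun setT (fun x : n.-tuple R => tnth x i).
  exact: measurable_tnth.
have b0 i : tnth b i = 0.
  have := mean i; rewrite unlock.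
  have E z : (tnth (affine A b z) i)%:E =
      ((dot (A i) (tnth z))%:E + (tnth b i)%:E)%E.
    by rewrite affE !tnth_mktuple.
  have ic : (std_normal k).-integrable setT (cst (tnth b i)%:E).
    exact: finite_measure_integrable_cst.
  rewrite transfer; first last.
  - rewrite (_ : _ \o _ =
        fun z => (dot (A i) (tnth z))%:E + cst (tnth b i)%:E z)%E.
      by apply: integrableD => //; exact: integrable_dot.
    by apply/funext => z /=; rewrite E.
  - exact/measurable_EFinP.
  under eq_integral do rewrite E.
  rewrite integralD//; last exact: integrable_dot.
  rewrite integral_dot add0e integral_cst//.
  by rewrite [X in (_ * X)%E]probability_setT mule1 => -[].
have linE z : affine A b z = lin A z.
  by rewrite affE; apply: eq_from_tnth => i; rewrite tnth_mktuple b0 addr0.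
exists k, A; split; last first.
  have -> : lin A = affine A b by apply/funext => z; rewrite linE.
  exact: muE'.
move=> i j; apply/EFin_inj; rewrite -cov unlock !mean /= unlock.
have [int_ij <-] := integral_dot_dot (A i) (A j).
have E z : tnth (affine A b z) i * tnth (affine A b z) j =
   dot (A i) (tnth z) * dot (A j) (tnth z).
  by rewrite linE !tnth_mktuple.
rewrite (_ : (fun w => _) =
    fun x : n.-tuple R => (tnth x i * tnth x j)%:E); last first.
  by apply/funext => x; congr (EFin (_ * _)); exact: subr0.
rewrite transfer.
- by apply: eq_integral => z _; rewrite E.
- by apply/measurable_EFinP; exact: measurable_funM.
- by apply: eq_integrable int_ij => // z _ /=; rewrite E.
Qed.

End linear_images.

(** * Positive semidefinite matrices are Gram matrices *)

Section psd.
Context {R : realType}.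

(** Cholesky factorization, by induction on the Schur complement of the first
    diagonal entry [a].  The inverse conventions cover [a = 0], where the first row
    of [S] vanishes. *)
Lemma psd_gram n (S : 'I_n -> 'I_n -> R) :
  (forall i j, S i j = S j i) ->
  (forall v, 0 <= dot v (fun i => dot (S i) v)) ->
  exists B : 'I_n -> 'I_n -> R, forall i j, dot (B i) (B j) = S i j.
Proof.
elim: n S => [|n IH] S symS psdS; first by exists S => -[].
pose a := S ord0 ord0.
pose u i := S (lift ord0 i) ord0.
pose S' i j := S (lift ord0 i) (lift ord0 j).
have quad t v : 0 <= a * t ^+ 2 + 2 * t * dot u v + dot v (fun i => dot (S' i) v).
  have := psdS (vec_cons t v); rewrite dot_vec_consl dotC dot_vec_consl.
  have -> : (fun j => S ord0 (lift ord0 j)) = u by apply/funext => j; rewrite symS.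
  have -> : (fun i => dot (S (lift ord0 i)) (vec_cons t v)) =
            (fun i => t * u i) \+ (fun i => dot (S' i) v).
    by apply/funext => i; rewrite dotC dot_vec_consl /= (dotC v).
  rewrite dotDr dotZr (dotC v u) => h; apply: le_trans h _.
  by rewrite le_eqVlt; apply/orP; left; apply/eqP; rewrite /a; ring.
have a0 : 0 <= a.
  by have := quad 1 (fun=> 0); rewrite expr1n mulr1 dot0r dot0l mulr0 !addr0.
(* otherwise quad, affine in t when a = 0, would be negative for some t *)
have u0 : a = 0 -> u = fun=> 0.
  move=> aE; apply: dot_eq0; apply/eqP; apply: contraT => uu.
  pose q := dot u (fun i => dot (S' i) u).
  have := quad (- (q + 1) / (2 * dot u u)) u; rewrite aE mul0r add0r -/q.
  have -> : 2 * (- (q + 1) / (2 * dot u u)) * dot u u = - (q + 1) by field.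
  by lra.
have [i j||B BE] := IH (fun i j => S' i j - u i * u j / a).
- by rewrite /S' symS [u i * _]mulrC.
- (* this value of t minimizes quad *)
  move=> v; have := quad (- dot u v / a) v.
  have -> : (fun i => dot (fun j => S' i j - u i * u j / a) v) =
     (fun i => dot (S' i) v) \- (fun i => (dot u v / a) * u i).
    apply/funext => i /=.
    rewrite -/(dot (S' i \- (fun j => u i * u j / a)) v) dotBl; congr (_ - _).
    rewrite [dot (fun j => _) v]dotC.
    have -> : (fun j => u i * u j / a) = (fun j => (u i / a) * u j).
      by apply/funext => j; rewrite mulrAC.
    by rewrite dotZr (dotC v u); ring.
  rewrite dotBr dotZr (dotC v u) => h; apply: le_trans h _.
  rewrite le_eqVlt; apply/orP; left; apply/eqP.
  have [->|an0] := eqVneq a 0; first by rewrite invr0; ring.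
  by field.
have sa : Num.sqrt a * Num.sqrt a = a by rewrite -expr2 sqr_sqrtr.
exists (fun i => if unlift ord0 i is Some i' then vec_cons (u i' / Num.sqrt a) (B i')
        else vec_cons (Num.sqrt a) (fun=> 0)).
have border i : Num.sqrt a * (u i / Num.sqrt a) = u i.
  have [a00|an0] := eqVneq a 0; first by rewrite a00 sqrtr0 mul0r u0.
  by rewrite mulrC divfK// sqrtr_eq0 -ltNge lt_neqAle eq_sym an0.
move=> i j; case: (unliftP ord0 i) => [i' ->|->];
  case: (unliftP ord0 j) => [j' ->|->]; rewrite dot_vec_cons ?dot0l ?dot0r ?addr0.
- rewrite BE /S' addrC.
  have -> : u i' / Num.sqrt a * (u j' / Num.sqrt a) = u i' * u j' / a.
    by rewrite mulrACA -invfM sa.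
  by rewrite subrK.
- by rewrite mulrC border.
- by rewrite border /u symS.
- by rewrite sa.
Qed.

Lemma psdmx_gram n (S : 'M[R]_n) : psdmx S ->
  exists B : 'I_n -> 'I_n -> R, forall i j, dot (B i) (B j) = S i j.
Proof.
move=> [symS psdS]; apply: psd_gram => [i j|v]; first by rewrite -[in LHS]symS mxE.
have := psdS (\col_i v i); rewrite -mulmxA mxE; congr (0 <= _).
apply: eq_bigr => i _; rewrite !mxE; congr (_ * _).
by apply: eq_bigr => j _; rewrite !mxE.
Qed.

End psd.

(** * The coupling *)

Section coupling.
Context {R : realType}.

Definition cat_vec k l (u : 'I_k -> R) (v : 'I_l -> R) (j : 'I_(k + l)) : R :=
  match fintype.split j with inl j => u j | inr j => v j end.

Lemma dot_cat k l (u u' : 'I_k -> R) (v v' : 'I_l -> R) :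
  dot (cat_vec u v) (cat_vec u' v') = dot u u' + dot v v'.
Proof.
rewrite /dot big_split_ord /cat_vec; congr (_ + _); apply: eq_bigr => j _.
  by rewrite (unsplitK (inl j)).
by rewrite (unsplitK (inr j)).
Qed.

Definition lin_pair n k (M N : 'I_n -> 'I_k -> R) (z : k.-tuple R) :
  (n.-tuple R * n.-tuple R)%type := (lin M z, lin N z).

Lemma measurable_lin_pair n k (M N : 'I_n -> 'I_k -> R) :
  measurable_fun setT (lin_pair M N).
Proof. by apply: measurable_fun_pair; exact: measurable_lin. Qed.

HB.instance Definition _ n k (M N : 'I_n -> 'I_k -> R) :=
  isMeasurableFun.Build _ _ _ _ (lin_pair M N) (measurable_lin_pair M N).

Lemma sqr_norm2_subt n (x y : n.-tuple R) :
  norm2 (subt x y) ^+ 2 = \sum_(i < n) (tnth x i - tnth y i) ^+ 2.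
Proof.
rewrite sqr_sqrtr; last by apply: sumr_ge0 => i _; exact: sqr_ge0.
by apply: eq_bigr => i _; rewrite tnth_mktuple.
Qed.

Lemma lin_pair_cost n k (M N : 'I_n -> 'I_k -> R) :
  (\int[distribution (std_normal k) (lin_pair M N)]_X
      (norm2 (subt X.1 X.2) ^+ 2)%:E =
   (\sum_(i < n) dot (M i \- N i) (M i \- N i))%:E)%E.
Proof.
rewrite ge0_integral_distribution; first last.
- by move=> X; rewrite lee_fin sqr_ge0.
- apply/measurable_EFinP; under eq_fun do rewrite sqr_norm2_subt.
  apply: (@measurable_sum _ _ _ _ _ _
    (fun i (X : n.-tuple R * n.-tuple R) => (tnth X.1 i - tnth X.2 i) ^+ 2)) => i.
  apply: measurable_funX; apply: measurable_funB.
    exact: (measurableT_comp (@measurable_tnth _ R n i) measurable_fst).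
  exact: (measurableT_comp (@measurable_tnth _ R n i) measurable_snd).
transitivity (\int[std_normal k]_z
    \sum_(i < n) (dot (M i \- N i) (tnth z) ^+ 2)%:E)%E.
  apply: eq_integral => z _ /=; rewrite sqr_norm2_subt sumEFin.
  by congr EFin; apply: eq_bigr => i _; rewrite !tnth_mktuple dotBl.
rewrite ge0_integral_sum//; first last.
- by move=> i z _; rewrite lee_fin sqr_ge0.
- move=> i; apply/measurable_EFinP; apply: measurable_funX.
  exact: measurable_dot.
by rewrite -sumEFin; apply: eq_bigr => i _; rewrite integral_dot_sqr.
Qed.

End coupling.

Theorem lemma2p2 (R : realType) (n : nat) (C Chat : 'M[R]_n)
    (kappa kappahat : probability (n.-tuple R) R)
    (hC : psdmx C) (hChat : psdmx Chat) (hCChat : psdmx (C - Chat))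
    (hkappa : centered_gaussian C kappa)
    (hkappahat : centered_gaussian Chat kappahat) :
  (W2 kappa kappahat <= (Num.sqrt (\tr (C - Chat)))%:E)%E.
Proof.
have [k [A [gramA lawA]]] := centered_gaussian_lin hkappa.
have [l [A' [gramA' lawA']]] := centered_gaussian_lin hkappahat.
have [B gramB] := psdmx_gram hCChat.
(* with Z = (Z1, Z2), the rows of N give Y = A' Z1 and those of M give
   Y + W, where W = B Z2 *)
pose M i := cat_vec (A' i) (B i).
pose N i := cat_vec (A' i) (fun=> 0 : R) : 'I_(l + n) -> R.
have gramM i j : dot (M i) (M j) = dot (A i) (A j).
  by rewrite dot_cat gramA' gramB gramA !mxE; ring.
have gramN i j : dot (N i) (N j) = dot (A' i) (A' j).
  by rewrite dot_cat dot0r addr0.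
have gramMN i : dot (M i \- N i) (M i \- N i) = dot (B i) (B i).
  by rewrite dotBl !dotBr !dot_cat !dot0r dot0l; ring.
have trE : \sum_(i < n) dot (M i \- N i) (M i \- N i) = \tr (C - Chat).
  by apply: eq_bigr => i _; rewrite gramMN gramB.
pose H : probability (n.-tuple R * n.-tuple R)%type R :=
  distribution (std_normal (l + n)) (lin_pair M N).
have HC : coupling kappa kappahat H.
  move=> D mD; rewrite lawA// lawA'//.
  rewrite -(law_lin_gram gramM mD) -(law_lin_gram gramN mD).
  split; congr (std_normal _ _); apply/seteqP.
    by split => z //= [].
  by split => z //= [].
have tr0 : 0 <= \tr (C - Chat).
  by rewrite -trE; apply: sumr_ge0 => i _; exact: dot_ge0.
rewrite -[leRHS]/(sqrte (\tr (C - Chat))%:E) lee_sqrt ?lee_fin//.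
rewrite -trE -lin_pair_cost.
by apply: ereal_inf_lbound; exists H.
Qed.
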